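(* Let $m,n$ be positive integers and let $(X,Y)$ be the bipartition of the complete bipartite graph $K_{m,n}$ with $|X|=m$ and $|Y|=n$. Let $F$ be any spanning forest of $K_{m,n}$ with components $T_1,T_2,\ldots,T_k$, and let $m_i=|X\cap V(T_i)|$ and $n_i=|Y\cap V(T_i)|$ for $i=1,\ldots,k$. Then the number $\tau_F(K_{m,n})$ of spanning trees of $K_{m,n}$ that contain all edges of $F$ equals $$\tau_{F}(K_{m,n})=\frac 1{mn}\left(\prod_{i=1}^k (m_in+n_im)\right)\left (1-\sum_{i=1}^{k}\frac{m_in_i}{m_in+n_im}\right ).$$
   Context: For a graph $G$ and a subgraph $H$, $\tau_H(G)$ denotes the number of spanning trees $T$ of $G$ with $E(H)\subseteq E(T)$. *)

(* Defs.v *)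
From mathcomp Require Import all_boot all_order all_algebra.

Set Implicit Arguments.
Unset Strict Implicit.
Unset Printing Implicit Defensive.

Import GRing.Theory.

(** A simple graph with vertex set [V] is given by its edge set, a set of
    two-element subsets of [V].  All subgraphs below are spanning subgraphs, so
    that a subgraph is a subset of the edge set. *)

Definition adj (V : finType) (E : {set {set V}}) : rel V :=
  [rel u v | [set u; v] \in E].

Definition connected (V : finType) (E : {set {set V}}) : bool :=
  [forall u, forall v, connect (adj E) u v].

(** Vertex sets of the connected components of [(V, E)]; an isolated vertex is a
    component. *)
Definition components (V : finType) (E : {set {set V}}) : {set {set V}} :=
  equivalence_partition (connect (adj E)) [set: V].

(** A cycle is a cyclic sequence of at least three distinct vertices.  Its
    length is bounded by [#|V|] only to make the predicate boolean: see
    [acyclicP]. *)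
Definition acyclic (V : finType) (E : {set {set V}}) : bool :=
  [forall k : 'I_#|V|.+1, forall p : k.-tuple V,
     ~~ [&& 2 < k, cycle (adj E) p & uniq p]].

Lemma acyclicP (V : finType) (E : {set {set V}}) :
  reflect (forall p : seq V, 2 < size p -> ~ ucycle (adj E) p) (acyclic E).
Proof.
apply: (iffP forallP) => [acE p p_gt2 /andP[cycp Up] | acE k].
  have lep : size p < #|V|.+1 by rewrite ltnS -(card_uniqP Up) max_card.
  have /forallP/(_ (in_tuple p))/negP[] := acE (Ordinal lep).
  by rewrite /= p_gt2 cycp Up.
apply/forallP=> p; apply/negP=> /and3P[k_gt2 cycp Up].
by apply: (acE p); [rewrite size_tuple | apply/andP].
Qed.

Definition spanning_forest (V : finType) (G F : {set {set V}}) : bool :=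
  (F \subset G) && acyclic F.

Definition spanning_tree (V : finType) (G T : {set {set V}}) : bool :=
  [&& T \subset G, connected T & acyclic T].

Definition tau (V : finType) (H G : {set {set V}}) : nat :=
  #|[set T : {set {set V}} | spanning_tree G T & H \subset T]|.

Definition Kmn (m n : nat) : {set {set ('I_m + 'I_n)}} :=
  [set [set inl x; inr y] | x : 'I_m, y : 'I_n].

Definition partX (m n : nat) : {set 'I_m + 'I_n} := [set inl x | x : 'I_m].
Definition partY (m n : nat) : {set 'I_m + 'I_n} := [set inr y | y : 'I_n].

(* Main.v *)
(** Induct on the number k of components of F.  A spanning tree containing F has
    exactly k - 1 further edges, so counting pairs (T, e) with T a spanning tree
    containing F and e an edge of T outside F gives
      (k - 1) tau(F) = sum of tau(F + e),
    over the edges e joining two distinct components of F.  The claimed formula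
    satisfies the same recurrence.  Acyclicity is handled through its
    characterisation "every edge is a bridge". *)

Require Import Defs.
From mathcomp Require Import all_boot all_order all_algebra.
From mathcomp Require Import ring.

Set Implicit Arguments.
Unset Strict Implicit.
Unset Printing Implicit Defensive.

Import GRing.Theory Num.Theory.

(** * Connectivity, components and acyclicity when an edge is added *)

Section Graphs.

Variable V : finType.
Implicit Types (E T : {set {set V}}) (u v x y : V) (C : {set V}).

Definition component E u : {set V} := [set v | connect (adj E) u v].

Lemma adjE E u v : adj E u v = ([set u; v] \in E).
Proof. by []. Qed.

Lemma adj_sym E : symmetric (adj E).
Proof. by move=> u v; rewrite !adjE setUC. Qed.

Lemma connect_adjC E : connect_sym (adj E).
Proof. exact/sym_connect_sym/adj_sym. Qed.

Lemma eq_component E x y : (component E x == component E y) = connect (adj E) x y.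
Proof.
apply/eqP/idP => [eqC | cxy].
  by have := connect0 (adj E) y; rewrite -[connect _ _ _]in_set -/(component E y) -eqC inE.
by apply/setP=> z; rewrite !inE (same_connect (connect_adjC E) cxy).
Qed.

Lemma componentsE E : components E = [set component E u | u : V].
Proof.
rewrite /components /equivalence_partition; apply/setP=> C.
by apply/imsetP/imsetP=> -[x _ ->]; exists x => //; apply/setP=> y; rewrite !inE.
Qed.

Lemma component_in E u : component E u \in components E.
Proof. by rewrite componentsE imset_f. Qed.

Lemma component_eq_mem E C u : C \in components E -> (component E u == C) = (u \in C).
Proof.
by rewrite componentsE => /imsetP[x _ ->]; rewrite eq_component inE connect_adjC.
Qed.

Lemma sub_connect_adj E T : E \subset T -> subrel (connect (adj E)) (connect (adj T)).
Proof. by move=> sET; apply: connect_sub => x y Exy; apply/connect1/(subsetP sET). Qed.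

Lemma set2_eq u v x y : [set x; y] = [set u; v] -> x = u /\ y = v \/ x = v /\ y = u.
Proof.
move=> e; have [xuv yuv] : x \in [set u; v] /\ y \in [set u; v] by rewrite -e set21 set22.
have [uxy vxy] : u \in [set x; y] /\ v \in [set x; y] by rewrite e set21 set22.
move: xuv yuv uxy vxy; rewrite !in_set2.
case/orP=> /eqP-> /orP[]/eqP->; rewrite !eqxx ?orbb; try by [left | right].
  by move=> _ /eqP->; left.
by move=> /eqP-> _; left.
Qed.

(** A path in the larger graph needs the new edge at most once, in one of its two directions. *)
Lemma connect_add_edge E u v x y :
  connect (adj ([set u; v] |: E)) x y =
  [|| connect (adj E) x y, connect (adj E) x u && connect (adj E) v y
    | connect (adj E) x v && connect (adj E) u y].
Proof.
have sE : E \subset [set u; v] |: E by apply: subsetUr.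
have cuv : connect (adj ([set u; v] |: E)) u v by apply: connect1; rewrite adjE setU11.
apply/idP/idP; last first.
  case/or3P=> [|/andP[]|/andP[]] /(sub_connect_adj sE) // cxu /(sub_connect_adj sE) cvy.
    exact: connect_trans cxu (connect_trans cuv cvy).
  by apply: connect_trans cxu (connect_trans _ cvy); rewrite connect_adjC.
case/connectP=> p; elim: p x => [|z p IHp] x /=.
  by move=> _ ->; rewrite connect0.
case/andP=> xz pthp ylast; have {IHp pthp ylast} := IHp z pthp ylast.
move: xz; rewrite adjE in_setU1 => /orP[/eqP/set2_eq[[-> ->]|[-> ->]] | xz].
- case/or3P=> [cvy|/andP[_ cvy]|/andP[_ ->]] //; by rewrite connect0 cvy ?orbT.
- case/or3P=> [cvy|/andP[_ ->]|/andP[_ cvy]] //; by rewrite connect0 cvy ?orbT.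
have cxz : connect (adj E) x z by apply: connect1.
by rewrite !(same_connect (connect_adjC E) cxz).
Qed.

(** An edge closes any path between its ends that avoids it into a cycle, and conversely. The
    condition [u != v] sets aside singletons in [E]: they are loops of [adj E] and lie on no cycle
    of three or more distinct vertices. *)
Lemma acyclic_bridgeP E :
  reflect (forall u v, u != v -> [set u; v] \in E ->
             ~~ connect (adj (E :\ [set u; v])) u v)
          (acyclic E).
Proof.
apply: (iffP (acyclicP E)) => [acE u v uv Euv | brE p].
  apply/negP=> /connectP[p pthp vlast].
  case/shortenP: pthp vlast => q pthq Uq _ vlast {p}.
  apply: (acE (u :: q)).
    (* Without an inner vertex, the path would force [u = v] or consist of the deleted edge. *)
    case: q pthq vlast {Uq} => [|z [|z' q]] //=.
      by move=> _ vu; rewrite vu eqxx in uv.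
    by move=> + vz; rewrite adjE vz setD11.
  apply/andP; split=> //; rewrite /cycle rcons_path; apply/andP; split.
    by apply: sub_path pthq => x y; rewrite !adjE => /setD1P[].
  by rewrite -vlast adj_sym.
case: p => [|a [|b [|c q]]] // _ /andP[cyc Up].
move: cyc Up; rewrite [cycle _ _]/= => /and3P[Eab Ebc pthq].
rewrite [uniq _]/= !inE !negb_or.
case/and4P=> /and3P[ab ac aq] /andP[bc bq] cq Uq.
have/negP[] := brE a b ab Eab.
rewrite connect_adjC.
(* The way from [b] through [c] and [q] back to [a] avoids the edge [ab]: its first edge because [c]
   differs from [a], the others because they miss [b]. *)
have Ebc' : adj (E :\ [set a; b]) b c.
  rewrite adjE in_setD1 -adjE Ebc andbT; apply: contraNneq ac => e.
  have : c \in [set a; b] by rewrite -e set22.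
  by rewrite in_set2 [c == b]eq_sym (negbTE bc) orbF eq_sym.
apply: connect_trans (connect1 Ebc') _.
apply/connectP; exists (rcons q a); last by rewrite last_rcons.
apply: (@sub_in_path _ [pred x | x != b]) pthq => [x y xb yb Exy|].
  rewrite adjE in_setD1 -adjE Exy andbT; apply/eqP=> e.
  have : b \in [set x; y] by rewrite e set22.
  by rewrite in_set2 ![b == _]eq_sym (negbTE xb) (negbTE yb).
rewrite /= eq_sym bc all_rcons /= ab; apply/allP=> z zq /=.
by apply: contraNneq bq => <-.
Qed.

Lemma acyclicS E T : E \subset T -> acyclic T -> acyclic E.
Proof.
move=> sET /acyclic_bridgeP acT; apply/acyclic_bridgeP=> u v uv Euv.
apply: contra (acT u v uv (subsetP sET _ Euv)).
by apply: sub_connect_adj; apply: setSD.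
Qed.

Lemma acyclic_add_edge E u v : u != v -> [set u; v] \notin E ->
  acyclic ([set u; v] |: E) = acyclic E && ~~ connect (adj E) u v.
Proof.
move=> uv nEuv; apply/idP/andP=> [acE | [acE ncuv]].
  split; first exact: acyclicS (subsetUr _ _) acE.
  by have /acyclic_bridgeP/(_ _ _ uv (setU11 _ _)) := acE; rewrite setU1K.
apply/acyclic_bridgeP=> x y xy; rewrite in_setU1.
case: eqP => [e _ | /eqP ne /= Exy].
  rewrite e setU1K //.
  by case/set2_eq: e => -[-> ->]; rewrite // connect_adjC.
rewrite setDUl.
have -> : [set [set u; v]] :\ [set x; y] = [set [set u; v]].
  by apply/setP=> z; rewrite !inE andbC; case: eqP => // ->; rewrite eq_sym ne.
rewrite connect_add_edge (negbTE (acyclic_bridgeP _ acE _ _ xy Exy)) /=.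
have cxy : connect (adj E) x y by apply: connect1.
have cE := sub_connect_adj (subsetDl E [set [set x; y]]).
(* If [x] and [y] stay joined through the new edge once [xy] is deleted, then [xy] itself joins [u]
   to [v] inside [E]. *)
apply: contra ncuv => /orP[]/andP[/cE cx /cE cy].
  rewrite (connect_adjC E x) in cx; rewrite (connect_adjC E v) in cy.
  by apply: connect_trans cx _; apply: connect_trans cxy _.
by rewrite connect_adjC in cx; rewrite connect_adjC; apply: connect_trans cx _;
  rewrite connect_adjC; apply: connect_trans cy _; rewrite connect_adjC.
Qed.

Lemma components_add_edge E u v :
  components ([set u; v] |: E) =
  (component E u :|: component E v)
    |: (components E :\ component E u :\ component E v).
Proof.
have compE x : component ([set u; v] |: E) x =
    if (x \in component E u) || (x \in component E v)
    then component E u :|: component E v else component E x.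
  apply/setP=> y; rewrite [LHS]inE connect_add_edge.
  rewrite !inE ![connect _ x _]connect_adjC.
  case cux: (connect _ u x) => /=.
    rewrite inE in_set in_set (same_connect (connect_adjC E) cux) /=.
    by rewrite connect_adjC; case: connect => //=; rewrite orbC; case: connect.
  case cvx: (connect _ v x) => /=; rewrite inE ?orbF ?inE connect_adjC //.
  by rewrite orbC (same_connect (connect_adjC E) cvx).
apply/setP=> C; rewrite [in LHS]componentsE !inE; apply/imsetP/idP.
  case=> x _ ->; rewrite compE; case: ifPn => [_ | ]; first by rewrite eqxx.
  rewrite !inE negb_or => /andP[cux cvx].
  rewrite component_in ![component E x == _]eq_sym !eq_component cux cvx.
  by rewrite orbT.
case/orP=> [/eqP-> | /and3P[Cv Cu]].
  by exists u => //; rewrite compE inE connect0.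
rewrite componentsE => /imsetP[x _ eC]; exists x => //.
rewrite compE eC ifN // !inE -!eq_component -eC.
by rewrite ![component E _ == _]eq_sym negb_or Cu Cv.
Qed.

Section BigComponents.
Variables (R : Type) (idx : R) (op : Monoid.com_law idx).
Variables (E : {set {set V}}) (u v : V).
Hypothesis ncuv : ~~ connect (adj E) u v.

(** Together with [big_components_split], this writes sums and products before and after the merger
    over the same untouched components. *)
Lemma big_components_add_edge (f : {set V} -> R) :
  \big[op/idx]_(C in components ([set u; v] |: E)) f C =
  op (f (component E u :|: component E v))
     (\big[op/idx]_(C in components E
        | (C != component E u) && (C != component E v)) f C).
Proof.
rewrite components_add_edge big_setU1 /=; last first.
  rewrite !inE; apply/negP=> /and3P[_ Cu Cin]; move: (Cu).
  by rewrite eq_sym component_eq_mem // inE inE connect0.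
apply: (congr1 (op _)); apply: eq_bigl => C; rewrite !inE.
by case: (C \in _); rewrite ?andbF //= !andbT andbC.
Qed.

Lemma big_components_split (f : {set V} -> R) :
  \big[op/idx]_(C in components E) f C =
  op (f (component E u)) (op (f (component E v))
     (\big[op/idx]_(C in components E
        | (C != component E u) && (C != component E v)) f C)).
Proof.
rewrite (bigD1 (component E u)) ?component_in //=.
rewrite (bigD1 (component E v)) /= ?component_in /=; last first.
  by rewrite eq_sym eq_component.
by do 2 apply: (congr1 (op _)); apply: eq_bigl => C; rewrite andbA.
Qed.

End BigComponents.

Lemma card_components_add_edge E u v : ~~ connect (adj E) u v ->
  #|components E| = #|components ([set u; v] |: E)|.+1.
Proof.
move=> ncuv; rewrite -!sum1_card big_components_add_edge.
by rewrite (big_components_split _ ncuv).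
Qed.

Lemma connected_components1 E u : connected E -> components E = [set [set: V]].
Proof.
move=> /forallP conE; rewrite componentsE; apply/setP=> C; rewrite !inE.
have cE x : component E x = [set: V].
  by apply/setP=> y; rewrite !inE (forallP (conE x)).
apply/imsetP/eqP=> [[x _ ->] | ->]; first exact: cE.
by exists u.
Qed.

Lemma components1_connected E : #|components E| = 1 -> connected E.
Proof.
case/eqP/cards1P=> C eC; apply/forallP=> x; apply/forallP=> y.
have := component_in E x; have := component_in E y.
by rewrite eC !inE -eq_component => /eqP-> /eqP->.
Qed.

End Graphs.

(** * Double counting of spanning trees that contain a forest *)

Section Counting.

Variable V : finType.
Implicit Types (E F G T : {set {set V}}) (u v x y : V) (C : {set V}).

Lemma acyclic_add_new_edge E u v : u != v -> acyclic E ->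
  (([set u; v] \notin E) && acyclic ([set u; v] |: E)) = ~~ connect (adj E) u v.
Proof.
move=> uv acE; case: (boolP ([set u; v] \in E)) => [Euv | nEuv] /=.
  by rewrite (connect1 (Euv : adj E u v)).
by rewrite acyclic_add_edge // acE.
Qed.

(** Adding the edges of [T] outside [F] one by one, each joins two distinct components, as [T] is
    acyclic, and so lowers their number by one. *)
Lemma card_components_acyclic F T :
  (forall e, e \in T -> #|e| = 2) -> F \subset T -> acyclic T ->
  #|components F| = #|T :\: F| + #|components T|.
Proof.
move=> edgeT sFT acT; move En: #|T :\: F| => k.
elim: k F sFT En => [|k IHk] F sFT En.
  have -> // : F = T.
  by apply/eqP; rewrite eqEsubset sFT -setD_eq0 -cards_eq0 En /=.
have [e /setDP[Te nFe]] : exists e, e \in T :\: F by apply/card_gt0P; rewrite En.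
have /eqP/cards2P[u [v [uv ee]]] := edgeT _ Te.
have sFT' : e |: F \subset T by rewrite subUset sub1set Te.
have : #|T :\: (e |: F)| = k.
  by apply/eq_add_S; rewrite -En (cardsD1 e (T :\: F)) in_setD nFe Te setUC setDDl.
rewrite {}ee in sFT' nFe *; move/(IHk _ sFT') => eqk.
rewrite (@card_components_add_edge _ F u v) ?eqk //.
by have := acyclicS sFT' acT; rewrite acyclic_add_edge // => /andP[].
Qed.

Lemma card_components_sub_tree G F T u : (forall e, e \in G -> #|e| = 2) ->
  spanning_tree G T -> F \subset T -> #|components F| = #|T :\: F|.+1.
Proof.
move=> edgeG /and3P[sTG conT acT] sFT.
rewrite (card_components_acyclic _ sFT) //; last by move=> e /(subsetP sTG)/edgeG.
by rewrite (connected_components1 u) // cards1 addn1.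
Qed.

Lemma tau_connected G F u : (forall e, e \in G -> #|e| = 2) ->
  spanning_forest G F -> #|components F| = 1 -> tau F G = 1.
Proof.
move=> edgeG /andP[sFG acF] F1; rewrite /tau -(cards1 F); congr #|pred_of_set _|.
apply/setP=> T; rewrite !inE; apply/andP/eqP => [[trT sFT] | ->].
  apply/eqP; rewrite eqEsubset sFT -setD_eq0 -cards_eq0 andbT.
  by have := card_components_sub_tree u edgeG trT sFT; rewrite F1 => -[<-].
by rewrite /spanning_tree sFG acF components1_connected.
Qed.

(** Both sides count pairs of a tree [T] containing [F] and an edge [e] of [T] outside [F]. The
    acyclicity condition loses no pair, since [e |: F] lies in [T]. *)
Lemma double_count_tau G F u : (forall e, e \in G -> #|e| = 2) ->
  #|components F|.-1 * tau F G =
  \sum_(e in G | (e \notin F) && acyclic (e |: F)) tau (e |: F) G.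
Proof.
move=> edgeG; rewrite mulnC /tau -sum_nat_const.
transitivity (\sum_(T in [set T | spanning_tree G T & F \subset T])
    \sum_(e in G | (e \notin F) && acyclic (e |: F)) (e \in T)).
  apply: eq_bigr => T; rewrite inE => /andP[trT sFT].
  rewrite (card_components_sub_tree u edgeG trT sFT) /= -sum1_card.
  rewrite -big_mkcondr /= [RHS]big_mkcond [LHS]big_mkcond; apply: eq_bigr => e _.
  rewrite inE; case: (boolP (e \in T)) => [eT|]; last by rewrite !andbF.
  case/and3P: trT => sTG _ acT; rewrite (subsetP sTG) // !andbT /=.
  by case: (e \in F) => //=; rewrite (@acyclicS _ _ T) // subUset sub1set eT.
rewrite exchange_big /=; apply: eq_bigr => e _.
rewrite -big_mkcondr sum1_card; apply: eq_card => T.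
by rewrite !inE unfold_in /= inE subUset sub1set; case: (e \in T); rewrite ?andbF ?andbT.
Qed.

End Counting.

(** * The algebraic identity behind the recurrence for the formula *)

Section WeightIdentity.

Local Open Scope ring_scope.

Variables (R : fieldType) (I : finType) (K : {set I}) (mu nu : I -> R).
Let M := \sum_(i in K) mu i.
Let N := \sum_(i in K) nu i.
Let a i := mu i * N + nu i * M.
Let s i := mu i * nu i / a i.
Let S := \sum_(i in K) s i.
Hypotheses (M0 : M != 0) (N0 : N != 0) (a0 : forall i, i \in K -> a i != 0).

(* Replacing [i] and [j] by one index of weights [mu i + mu j], [nu i + nu j]
   multiplies [prod a] by [(ai + aj) / (ai * aj)] and changes [1 - S]; the product
   of both effects is [prod a * merge_factor], where [wij = mu i * nu j + mu j * nu i]. *)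
Definition merge_factor (S ai si aj sj wij : R) : R :=
  (1 - S) * (ai^-1 + aj^-1) + (si / ai + sj / aj) - wij / (ai * aj).

(** For components with [mu i] and [nu i] vertices on the two sides, [mu i * nu j] counts the edges
    from the first side of [i] to the second side of [j]. The sum is extended to all ordered pairs,
    where it factors into single sums, and the diagonal is subtracted. *)
Lemma sum_merge_factor :
  \sum_(i in K) \sum_(j in K | j != i)
     mu i * nu j * merge_factor S (a i) (s i) (a j) (s j) (mu i * nu j + mu j * nu i)
  = (#|K|%:R - 1) * (1 - S).
Proof.
pose G i j := mu i * nu j *
  merge_factor S (a i) (s i) (a j) (s j) (mu i * nu j + mu j * nu i).
change (\sum_(i in K) \sum_(j in K | j != i) G i j = (#|K|%:R - 1) * (1 - S)).
have offdiag i : i \in K -> \sum_(j in K | j != i) G i j = \sum_(j in K) G i j - G i i.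
  by move=> Ki; rewrite [in RHS](bigD1 i) //= addrAC subrr add0r.
rewrite (eq_bigr _ offdiag) sumrB.
(* At [i = j] the last two terms of [merge_factor] cancel. *)
have -> : \sum_(i in K) G i i = 2 * (1 - S) * S.
  rewrite mulr_sumr; apply: eq_bigr => i /a0 ai0.
  by rewrite /G /merge_factor /s; field.
pose U := \sum_(i in K) mu i / a i; pose V := \sum_(i in K) nu i / a i.
pose U' := \sum_(i in K) mu i * s i / a i; pose V' := \sum_(i in K) nu i * s i / a i.
pose A := \sum_(i in K) mu i ^+ 2 / a i; pose B := \sum_(i in K) nu i ^+ 2 / a i.
have -> : \sum_(i in K) \sum_(j in K) G i j =
    (1 - S) * (U * N + M * V) + (U' * N + M * V') - A * B - S * S.
  rewrite /G /merge_factor; move: (1 - S) => c.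
  rewrite mulrDr -!mulNr !mulrA [c * U]mulr_sumr [c * M]mulr_sumr -!sumrN.
  rewrite !big_distrlr /= -!big_split /=; apply: eq_bigr => i /a0 ai0.
  rewrite -!big_split /=; apply: eq_bigr => j /a0 aj0.
  by rewrite /s; field; apply/andP.
(* The [i]-th terms add up to [a i / a i]; in the next identity the same happens with the extra
   factor [s i]. *)
have -> : U * N + M * V = #|K|%:R.
  rewrite mulr_suml mulr_sumr -big_split -sum1_card natr_sum /=.
  by apply: eq_bigr => i /a0 ai0; rewrite -[RHS](divff ai0) {3}/a; field.
have -> : U' * N + M * V' = S.
  rewrite mulr_suml mulr_sumr -big_split /=.
  apply: eq_bigr => i /a0 ai0; rewrite -[RHS](mulfK ai0) {3}/a; field.
  exact: ai0.
(* [mu i = mu i * a i / a i = N * mu i ^ 2 / a i + M * s i], summed over [i]. *)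
have eA : A = (1 - S) * M / N.
  apply: (mulIf N0); rewrite mulfVK // mulrBl mul1r; apply/eqP; rewrite eq_sym subr_eq.
  rewrite mulr_suml mulr_suml -big_split /=; apply/eqP; apply: eq_bigr => i /a0 ai0.
  by rewrite -[LHS](mulfK ai0) {1}/a /s; field.
have eB : B = (1 - S) * N / M.
  apply: (mulIf M0); rewrite mulfVK // mulrBl mul1r; apply/eqP; rewrite eq_sym subr_eq.
  rewrite mulr_suml mulr_suml -big_split /=; apply/eqP; apply: eq_bigr => i /a0 ai0.
  by rewrite -[LHS](mulfK ai0) {1}/a /s; field.
(* Here [A * B = (1 - S)^2], and [S - (1 - S)^2 - S^2 - 2(1 - S)S = -(1 - S)]. *)
by rewrite eA eB; field; rewrite M0.
Qed.

End WeightIdentity.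

(** * The recurrence and the closed formula for the complete bipartite graph *)

Section CompleteBipartite.

Variables m n : nat.
Implicit Types (F E : {set {set ('I_m + 'I_n)}}) (C D : {set ('I_m + 'I_n)}).

Lemma Kmn_edge e : e \in Kmn m n -> #|e| = 2.
Proof. by case/imset2P=> x y _ _ ->; rewrite cards2. Qed.

Lemma big_Kmn (P : pred {set ('I_m + 'I_n)}) (f : {set ('I_m + 'I_n)} -> nat) :
  \sum_(e in Kmn m n | P e) f e =
  \sum_(x < m) \sum_(y < n | P [set inl x; inr y]) f [set inl x; inr y].
Proof.
pose g (p : 'I_m * 'I_n) : {set ('I_m + 'I_n)} := [set inl p.1; inr p.2].
have -> : Kmn m n = [set g p | p in [set: 'I_m * 'I_n]].
  apply/setP=> e; apply/imset2P/imsetP=> [[x y _ _ ->] | [[x y] _ ->]].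
    by exists (x, y).
  by exists x y.
have g_inj : injective g.
  by move=> [x y] [x' y'] /set2_eq[] [] // [->] [->].
rewrite big_mkcondr big_imset /=; last by move=> ? ? _ _ /g_inj.
under [RHS]eq_bigr do rewrite big_mkcond.
by rewrite pair_big /=; apply: eq_bigl => p; rewrite inE.
Qed.

Lemma tau_Kmn_rec F : (0 < m)%N -> spanning_forest (Kmn m n) F ->
  #|components F|.-1 * tau F (Kmn m n) =
  \sum_(x < m) \sum_(y < n | ~~ connect (adj F) (inl x) (inr y))
     tau ([set inl x; inr y] |: F) (Kmn m n).
Proof.
move=> m_gt0 /andP[_ acF].
rewrite (double_count_tau F (inl (Ordinal m_gt0)) Kmn_edge).
rewrite big_Kmn; apply: eq_bigr => x _; apply: eq_bigl => y.
by rewrite acyclic_add_new_edge.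
Qed.

Local Open Scope ring_scope.

Definition cardX C : rat := #|partX m n :&: C|%:R.
Definition cardY C : rat := #|partY m n :&: C|%:R.
(** This is the sum of the degrees in the complete bipartite graph of the vertices of [C]. *)
Definition weight C : rat := cardX C * n%:R + cardY C * m%:R.

Lemma cardU_components (V : finType) (E : {set {set V}}) u v (A : {set V}) :
  ~~ connect (adj E) u v ->
  #|A :&: (component E u :|: component E v)|%:R =
  #|A :&: component E u|%:R + #|A :&: component E v|%:R :> rat.
Proof.
move=> ncuv; rewrite -natrD setIUr cardsU.
suff -> : A :&: component E u :&: (A :&: component E v) = set0 by rewrite cards0 subn0.
apply/setP=> z; rewrite !inE; apply: contraNF ncuv => /andP[/andP[_ cuz] /andP[_ cvz]].
by rewrite connect_adjC in cvz; exact: connect_trans cuz cvz.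
Qed.

Lemma weight_gt0 F C : (0 < m)%N -> (0 < n)%N -> C \in components F -> 0 < weight C.
Proof.
move=> m_gt0 n_gt0; rewrite componentsE => /imsetP[u _ ->].
rewrite /weight /cardX /cardY -!natrM -natrD ltr0n addn_gt0 !muln_gt0 m_gt0 n_gt0 !andbT.
case: u => z; apply/orP; [left | right]; apply/card_gt0P.
  by exists (inl z); rewrite !inE connect0 imset_f.
by exists (inr z); rewrite !inE connect0 imset_f.
Qed.

Definition tau_formula F : rat :=
  1 / (m%:R * n%:R) * (\prod_(C in components F) weight C) *
  (1 - \sum_(C in components F) (cardX C * cardY C) / weight C).

(** Part sizes and weights add up when two components merge; the other components are unchanged. *)
Lemma tau_formula_add_edge F u v : (0 < m)%N -> (0 < n)%N ->
  ~~ connect (adj F) u v ->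
  let S := \sum_(C in components F) (cardX C * cardY C) / weight C in
  let C := component F u in let D := component F v in
  tau_formula ([set u; v] |: F) =
  1 / (m%:R * n%:R) * (\prod_(C in components F) weight C) *
  merge_factor S (weight C) (cardX C * cardY C / weight C)
     (weight D) (cardX D * cardY D / weight D)
     (cardX C * cardY D + cardX D * cardY C).
Proof.
move=> m_gt0 n_gt0 ncuv /=.
have Cgt0 := weight_gt0 m_gt0 n_gt0 (component_in F u).
have Dgt0 := weight_gt0 m_gt0 n_gt0 (component_in F v).
rewrite /tau_formula !big_components_add_edge.
rewrite !(big_components_split _ ncuv) /=.
set S' := \sum_(_ in _ | _) _; set P' := \prod_(_ in _ | _) _.
set C := component F u in Cgt0 *; set D := component F v in Dgt0 *.
have mU : cardX (C :|: D) = cardX C + cardX D by apply: cardU_components.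
have nU : cardY (C :|: D) = cardY C + cardY D by apply: cardU_components.
have aU : weight (C :|: D) = weight C + weight D by rewrite /weight mU nU; ring.
rewrite aU mU nU /merge_factor.
(* Positivity is kept because the denominator [a + b] must not vanish either. *)
move: (weight C) (weight D) Cgt0 Dgt0 => a b a_gt0 b_gt0.
have mR : (m%:R : rat) != 0 by rewrite pnatr_eq0 -lt0n.
have nR : (n%:R : rat) != 0 by rewrite pnatr_eq0 -lt0n.
field; rewrite nR mR !lt0r_neq0 //; exact: addr_gt0.
Qed.

(** The indices are grouped by the component of [f i]; [f] will be the inclusion of either side. *)
Lemma sum_over_component (I V : finType) (f : I -> V) (E : {set {set V}})
    (g : {set V} -> rat) : injective f ->
  \sum_i g (component E (f i)) =
  \sum_(C in components E) #|[set f i | i : I] :&: C|%:R * g C.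
Proof.
move=> f_inj.
rewrite (partition_big (component E \o f) (mem (components E))) /=; last first.
  by move=> i _; apply: component_in.
apply: eq_bigr => C CE.
rewrite (eq_bigr (fun=> g C)); last by move=> i /eqP->.
rewrite sumr_const mulr_natl; congr (_ *+ _).
have -> : [set f i | i : I] :&: C = f @: [set i | f i \in C].
  apply/setP=> z; rewrite inE; apply/andP/imsetP=> [[/imsetP[i _ ->] fiC] | [i + ->]].
    by exists i; rewrite // inE.
  by rewrite inE => ?; rewrite imset_f.
rewrite card_imset //; apply: eq_card => i.
by rewrite [RHS]inE; exact: component_eq_mem.
Qed.

Lemma tau_KmnE F : (0 < m)%N -> (0 < n)%N -> spanning_forest (Kmn m n) F ->
  (tau F (Kmn m n))%:R = tau_formula F.
Proof.
move=> m_gt0 n_gt0.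
have inl_inj : injective (@inl 'I_m 'I_n) by move=> ? ? [].
have inr_inj : injective (@inr 'I_m 'I_n) by move=> ? ? [].
have sumX E (g : {set ('I_m + 'I_n)} -> rat) :
    \sum_(x < m) g (component E (inl x)) = \sum_(C in components E) cardX C * g C.
  exact: sum_over_component.
have sumY E (g : {set ('I_m + 'I_n)} -> rat) :
    \sum_(y < n) g (component E (inr y)) = \sum_(C in components E) cardY C * g C.
  exact: sum_over_component.
have mR : (m%:R : rat) != 0 by rewrite pnatr_eq0 -lt0n.
have nR : (n%:R : rat) != 0 by rewrite pnatr_eq0 -lt0n.
have mE E : \sum_(C in components E) cardX C = m%:R.
  rewrite -[in RHS](card_ord m) -sum1_card natr_sum (sumX E (fun=> 1)).
  by apply: eq_bigr => C _; rewrite mulr1.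
have nE E : \sum_(C in components E) cardY C = n%:R.
  rewrite -[in RHS](card_ord n) -sum1_card natr_sum (sumY E (fun=> 1)).
  by apply: eq_bigr => C _; rewrite mulr1.
pose x0 : 'I_m + 'I_n := inl (Ordinal m_gt0).
(* The induction runs on the number of components minus one, the number of edges still missing. *)
have [k Ek] : exists k, #|components F| = k.+1.
  exists #|components F|.-1; rewrite prednK //; apply/card_gt0P.
  by exists (component F x0); apply: component_in.
elim: k F Ek => [|k IHk] F Ek forestF.
  rewrite (tau_connected x0 Kmn_edge) //.
  rewrite /tau_formula (connected_components1 x0) ?components1_connected //.
  have := mE F; have := nE F.
  rewrite (connected_components1 x0) ?components1_connected // !big_set1.
  (* With one component the product is [2mn] and the last factor is [1 - 1/2]. *)
  move=> en em; rewrite /weight en em.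
  have -> : m%:R * n%:R + n%:R * m%:R = 2 * (m%:R * n%:R) :> rat by ring.
  by field; rewrite nR mR.
have k0 : (k.+1%:R : rat) != 0 by rewrite pnatr_eq0.
apply: (mulfI k0); rewrite -natrM.
have := tau_Kmn_rec m_gt0 forestF; rewrite Ek /= => ->.
rewrite natr_sum.
set c := 1 / (m%:R * n%:R) * (\prod_(C in components F) weight C).
set S := \sum_(C in components F) (cardX C * cardY C) / weight C.
pose G C D := merge_factor S (weight C) (cardX C * cardY C / weight C)
     (weight D) (cardX D * cardY D / weight D)
     (cardX C * cardY D + cardX D * cardY C).
(* With the condition moved into the summand, each term depends on [x] and [y] only through their
   components, as [sumX] and [sumY] require. *)
transitivity (\sum_(x < m) \sum_(y < n)
   (if component F (inr y) != component F (inl x)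
    then c * G (component F (inl x)) (component F (inr y)) else 0)).
  apply: eq_bigr => x _; rewrite natr_sum big_mkcond; apply: eq_bigr => y _.
  rewrite eq_component [connect _ (inr y) _]connect_adjC; case: ifPn => // ncxy.
  rewrite IHk ?tau_formula_add_edge //.
    by apply/eq_add_S; rewrite -card_components_add_edge.
  case/andP: forestF => sFG acF.
  have := ncxy; rewrite -acyclic_add_new_edge // => /andP[_ acF'].
  rewrite /spanning_forest acF' andbT subUset sFG andbT sub1set.
  by apply/imset2P; exists x y.
have := @sum_merge_factor _ _ (components F) cardX cardY.
rewrite mE nE Ek => /(_ mR nR) sumG.
have a0 C : C \in components F -> weight C != 0.
  by move=> /(weight_gt0 m_gt0 n_gt0) ?; rewrite lt0r_neq0.
(* [F] has [k.+2] components, so the identity yields the factor [k.+1]. *)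
transitivity (c * ((k.+2%:R - 1) * (1 - S))); last first.
  by rewrite /tau_formula -/c -/S [k.+2%:R]mulrS; ring.
rewrite -(sumG a0) mulr_sumr.
rewrite (sumX F (fun C => \sum_(y < n) if component F (inr y) != C
    then c * G C (component F (inr y)) else 0)).
apply: eq_bigr => C _.
rewrite (sumY F (fun D => if D != C then c * G C D else 0)) !mulr_sumr.
rewrite [RHS]big_mkcondr; apply: eq_bigr => D _.
by case: ifP => _; rewrite ?mulr0 // /G /S; ring.
Qed.

End CompleteBipartite.

Unset Implicit Arguments.

Local Open Scope ring_scope.

Theorem theorem1p4 (m n : nat) (m_gt0 : (0 < m)%N) (n_gt0 : (0 < n)%N)
    (F : {set {set ('I_m + 'I_n)}}) (forestF : spanning_forest (Kmn m n) F) :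
  let mC (C : {set 'I_m + 'I_n}) : rat := #|partX m n :&: C|%:R in
  let nC (C : {set 'I_m + 'I_n}) : rat := #|partY m n :&: C|%:R in
  (tau F (Kmn m n))%:R =
    1 / (m%:R * n%:R) *
    (\prod_(C in components F) (mC C * n%:R + nC C * m%:R)) *
    (1 - \sum_(C in components F)
           (mC C * nC C) / (mC C * n%:R + nC C * m%:R)) :> rat.
Proof.
exact: tau_KmnE.
Qed.
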